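(* Let $n\ge1$ be an integer, let $f:\mathbb{R}\to\mathbb{R}$ be an $n$ times differentiable function, and let $x_1<\cdots<x_{n+1}$ be real numbers. Put $$\Delta^{n+1}_f(x_1,\ldots,x_{n+1}):=\sum_{i=1}^{n+1}\frac{f(x_i)}{\prod_{1\le j\le n+1,\,j\ne i}(x_i-x_j)} .$$ Then $$\Delta^{n+1}_f(x_1,\ldots,x_{n+1})=\frac{1}{n!}\int_{\Delta_n}f^{(n)}\Bigl(\sum_{i=1}^{n+1}a_ix_i\Bigr)\,dp_n(a_1,\ldots,a_{n+1}),$$ where $\Delta_n=\{(a_1,\ldots,a_{n+1})\in\mathbb{R}^{n+1}: a_i\ge0,\ \sum_ia_i=1\}$ and $p_n$ is the uniform probability measure on $\Delta_n$. Hence there exists a point $z\in[x_1,x_{n+1}]$ such that $$f^{(n)}(z)=n!\,\Delta^{n+1}_f(x_1,\ldots,x_{n+1}).$$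
   Context: $f^{(n)}$ is the $n$-th derivative of $f$. The uniform probability measure on the simplex $\Delta_n$ is normalized $n$-dimensional Lebesgue measure on it.
   Formalization: The integral formula is stated under the added assumption that the integrand is Lebesgue integrable on the simplex, since for f merely n times differentiable the integral may not exist (e.g. n=1, f(t)=t² sin(1/t²), x_1=0); the existence of z is unconditional. *)

(* Defs.v *)
From HB Require Import structures.
From mathcomp Require Import all_boot all_order all_algebra.
From mathcomp Require Import all_classical all_reals all_analysis.

Set Implicit Arguments.
Unset Strict Implicit.
Unset Printing Implicit Defensive.

Import Order.TTheory GRing.Theory Num.Theory.
Import numFieldNormedType.Exports.

Local Open Scope ring_scope.
Local Open Scope classical_set_scope.

Section DividedDifference.
Context {R : realType}.

Definition divided_difference n (f : R -> R) (x : 'I_n.+1 -> R) : R :=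
  \sum_(i < n.+1) f (x i) / \prod_(j < n.+1 | j != i) (x i - x j).

Definition n_times_differentiable n (f : R -> R) : Prop :=
  forall k, (k < n)%N -> forall t, derivable f^`(k) t 1.

End DividedDifference.

Definition cons_pair {R : realType} n (p : R * n.-tuple R) : n.+1.-tuple R :=
  [tuple of p.1 :: p.2].

(* The n-fold product of the Lebesgue measure, as a measure on R^n. *)
Fixpoint lebesgue_tuple {R : realType} n : set (n.-tuple R) -> \bar R :=
  match n with
  | 0 => dirac [tuple]
  | n'.+1 =>
      pushforward (lebesgue_measure \x @lebesgue_tuple R n')%E (@cons_pair R n')
  end.
Arguments lebesgue_tuple R n : clear implicits.

Section SigmaFinitePushforward.
Local Open Scope ereal_scope.
Context d1 d2 (T1 : measurableType d1) (T2 : measurableType d2) (R : realType).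
Variables (m : {measure set T1 -> \bar R}) (g : T1 -> T2).
Hypothesis mg : measurable_fun setT g.
Hypothesis sfg : sigma_finite setT (pushforward m g).

Let pf := pushforward m g.
Let pf0 : pf set0 = 0. Proof. exact: measure0. Qed.
Let pf_ge0 A : 0 <= pf A. Proof. exact: measure_ge0. Qed.
Let pf_sigma_additive : semi_sigma_additive pf.
Proof. exact: measure_semi_sigma_additive. Qed.

HB.instance Definition _ := isMeasure.Build _ _ _ pf
  pf0 pf_ge0 pf_sigma_additive.
HB.instance Definition _ := Measure_isSigmaFinite.Build _ _ _ pf sfg.

Lemma sigma_finite_pushforward :
  exists nu : {sigma_finite_measure set T2 -> \bar R},
    pushforward m g = nu :> (set T2 -> \bar R).
Proof. by exists pf. Qed.

End SigmaFinitePushforward.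

Definition box (R : realType) n (a b : R) : set (n.-tuple R) :=
  [set v | forall i, a <= tnth v i <= b].
Arguments box {R} n.

Section LebesgueTupleTheory.
Context {R : realType}.

Lemma measurable_box n (a b : R) : measurable (box n a b).
Proof.
rewrite (_ : box _ _ _ =
    \big[setI/setT]_(i < n) ((@tnth _ R ^~ i) @^-1` `[a, b])).
  apply: bigsetI_measurable => i _; rewrite -[X in measurable X]setTI.
  exact: measurable_tnth.
rewrite -bigcap_seq; apply/seteqP; split => v /=.
  by move=> h i _; rewrite /= in_itv/= h.
move=> h i; have := h i; rewrite /= in_itv; apply.
by rewrite mem_index_enum.
Qed.

Let lebesgue_tuple_spec n :
  exists2 mu : {sigma_finite_measure set (n.-tuple R) -> \bar R},
    lebesgue_tuple R n = mu &
    forall a b : R, a <= b -> mu (box n a b) = ((b - a) ^+ n)%:E.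
Proof.
elim: n => [|n [mu mE muB]].
  exists (dirac [tuple]) => // a b ab; rewrite expr0 /= diracE.
  by rewrite mem_set// => -[].
have B (a b : R) : a <= b ->
    pushforward (lebesgue_measure \x mu)%E (@cons_pair R n) (box n.+1 a b) =
    ((b - a) ^+ n.+1)%:E.
  move=> ab; rewrite /pushforward.
  rewrite (_ : _ @^-1` _ = `[a, b] `*` box n a b); last first.
    apply/seteqP; split => -[t v] /=.
      move=> h; split; first (have := h ord0).
        by rewrite in_itv.
      by move=> i; have := h (lift ord0 i); rewrite tnthS.
    rewrite in_itv/= => -[h1 h2] i; case: (unliftP ord0 i) => [j ->|->] //.
    by rewrite tnthS.
  rewrite product_measure1E//=; last exact: measurable_box.
  have -> : lebesgue_measure (`[a, b] : set R) = (b - a)%:E.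
    rewrite lebesgue_measure_itv/= lte_fin.
    by case: ltgtP ab => // ->; rewrite subrr.
  by rewrite muB// exprS EFinM.
have SF : sigma_finite setT
    (pushforward (lebesgue_measure \x mu)%E (@cons_pair R n)).
  exists (fun k => box n.+1 (- k%:R) k%:R).
    apply/esym/seteqP; split => // v _.
    exists (\max_(i < n.+1) Num.bound `|tnth v i|)%N => //= i.
    rewrite -ler_norml.
    apply: (le_trans (ltW (archi_boundP (normr_ge0 _)))).
    rewrite ler_nat.
    exact: (leq_bigmax (F := fun i => Num.bound `|tnth v i|)).
  move=> k; split; first exact: measurable_box.
  by rewrite B ?ltry// lerNl; apply: le_trans (_ : 0 <= _); rewrite ?oppr_le0.
have mc : measurable_fun setT (@cons_pair R n) by exact: measurable_cons.
have [nu nuE] := @sigma_finite_pushforward _ _ _ _ R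
  (lebesgue_measure \x mu)%E _ mc SF.
exists nu; first by rewrite /= mE.
by move=> a b ab; rewrite -nuE B.
Qed.

Section instances.
Variable n : nat.

Let lebesgue_tuple0 : lebesgue_tuple R n set0 = 0%E.
Proof. by have [mu -> _] := lebesgue_tuple_spec n; exact: measure0. Qed.

Let lebesgue_tuple_ge0 A : (0 <= lebesgue_tuple R n A)%E.
Proof. by have [mu -> _] := lebesgue_tuple_spec n; exact: measure_ge0. Qed.

Let lebesgue_tuple_sigma_additive : semi_sigma_additive (lebesgue_tuple R n).
Proof.
by have [mu -> _] := lebesgue_tuple_spec n; exact: measure_semi_sigma_additive.
Qed.

HB.instance Definition _ := isMeasure.Build _ _ _ (lebesgue_tuple R n)
  lebesgue_tuple0 lebesgue_tuple_ge0 lebesgue_tuple_sigma_additive.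

Let lebesgue_tuple_sigma_finite : sigma_finite setT (lebesgue_tuple R n).
Proof. by have [mu -> _] := lebesgue_tuple_spec n; exact: sigma_finiteT. Qed.

HB.instance Definition _ := Measure_isSigmaFinite.Build _ _ _
  (lebesgue_tuple R n) lebesgue_tuple_sigma_finite.

End instances.

Lemma lebesgue_tuple_box n (a b : R) : a <= b ->
  lebesgue_tuple R n (box n a b) = ((b - a) ^+ n)%:E.
Proof. by have [mu -> muB] := lebesgue_tuple_spec n; exact: muB. Qed.

End LebesgueTupleTheory.

Definition simplex (R : realType) n : set (n.+1.-tuple R) :=
  [set a | (forall i, 0 <= tnth a i) /\ \sum_(i < n.+1) tnth a i = 1].
Arguments simplex : clear implicits.

(* The hyperplane of equation a_0 + ... + a_n = 1 is parametrized by its last n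
   coordinates; corner R n is the set of parameters of the points of
   simplex R n. *)
Definition simplex_chart (R : realType) n (v : n.-tuple R) : n.+1.-tuple R :=
  [tuple of (1 - \sum_(i < n) tnth v i) :: v].

Definition corner (R : realType) n : set (n.-tuple R) :=
  [set v | (forall i, 0 <= tnth v i) /\ \sum_(i < n) tnth v i <= 1].
Arguments corner : clear implicits.

Section UniformSimplex.
Context {R : realType}.

Lemma corner_simplex n : corner R n = @simplex_chart R n @^-1` simplex R n.
Proof.
apply/seteqP; split => v [v0 v1]; split.
- move=> i; case: (unliftP ord0 i) => [j ->|->]; last by rewrite subr_ge0.
  by rewrite tnthS.
- rewrite big_ord_recl /=; under eq_bigr do rewrite tnthS.
  by rewrite /= subrK.
- by move=> i; have := v0 (lift ord0 i); rewrite tnthS.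
- by have := v0 ord0; rewrite subr_ge0.
Qed.

Lemma measurable_simplex_chart n : measurable_fun setT (@simplex_chart R n).
Proof.
apply: measurable_cons => //; apply: measurable_realfun.measurable_funB => //.
by apply: measurable_sum => i; exact: measurable_tnth.
Qed.

HB.instance Definition _ n := isMeasurableFun.Build _ _ _ _
  (@simplex_chart R n) (@measurable_simplex_chart n).

Lemma measurable_simplex n : measurable (simplex R n).
Proof.
rewrite (_ : simplex R n = \big[setI/setT]_(i < n.+1)
    ((@tnth _ R ^~ i) @^-1` `[0, +oo[) `&`
  ((fun a : n.+1.-tuple R => \sum_(i < n.+1) tnth a i) @^-1` [set 1])).
  apply: measurableI.
    apply: bigsetI_measurable => i _; rewrite -[X in measurable X]setTI.
    exact: measurable_tnth.
  rewrite -[X in measurable X]setTI.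
  have : measurable_fun setT
      (fun a : n.+1.-tuple R => \sum_(i < n.+1) tnth a i).
    by apply: measurable_sum => i; exact: measurable_tnth.
  exact.
rewrite -bigcap_seq; apply/seteqP; split => a /= [a0 a1]; split => //.
  by move=> i _; rewrite /= in_itv /= a0.
move=> i; have := a0 i; rewrite /= in_itv /= andbT; apply.
by rewrite mem_index_enum.
Qed.

Lemma measurable_corner n : measurable (corner R n).
Proof.
rewrite corner_simplex -[X in measurable X]setTI.
apply: measurable_simplex_chart; first exact: measurableT.
exact: measurable_simplex.
Qed.

Lemma lebesgue_tuple_corner n : (0 < lebesgue_tuple R n (corner R n) < +oo)%E.
Proof.
have cube_gt0 : (0 < lebesgue_tuple R n (box n 0 n.+1%:R^-1))%E.
  by rewrite lebesgue_tuple_box// subr0 lte_fin exprn_gt0// invr_gt0.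
have cube_lty : (lebesgue_tuple R n (box n 0 1) < +oo)%E.
  by rewrite lebesgue_tuple_box// ltry.
apply/andP; split.
  apply: (lt_le_trans cube_gt0); apply: le_measure; rewrite ?inE.
  - exact: measurable_box.
  - exact: measurable_corner.
  move=> v vB; split => [i|]; first by have /andP[] := vB i.
  apply: (@le_trans _ _ (\sum_(i < n) n.+1%:R^-1)).
    by apply: ler_sum => i _; have /andP[] := vB i.
  rewrite sumr_const card_ord -[leLHS]mulr_natl ler_pdivrMr// mul1r.
  by rewrite ler_nat.
apply: (le_lt_trans _ cube_lty); apply: le_measure; rewrite ?inE.
- exact: measurable_corner.
- exact: measurable_box.
move=> v [v0 v1] i; rewrite v0/=; apply: le_trans v1.
by rewrite (bigD1 i)//= lerDl sumr_ge0.
Qed.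

(* The restriction to the simplex of the n-dimensional Lebesgue measure of the
   hyperplane, normalized.  The chart is affine, so the measure it transports
   from R^n is the n-dimensional Lebesgue measure of the hyperplane up to a
   constant factor, which disappears in the normalization.  The Dirac measure
   is only the default value of mnormalize for a measure of total mass 0 or
   +oo; it plays no role here by lebesgue_tuple_corner. *)
Definition uniform_simplex n : probability (n.+1.-tuple R) R :=
  distribution
    (mnormalize (mrestr (lebesgue_tuple R n) (@measurable_corner n))
                (dirac [tuple of nseq n (0 : R)]))
    (@simplex_chart R n).

Lemma uniform_simplexE n (A : set (n.+1.-tuple R)) :
  uniform_simplex n A =
  (lebesgue_tuple R n (@simplex_chart R n @^-1` A `&` corner R n) *
   (fine (lebesgue_tuple R n (corner R n)))^-1%:E)%E.
Proof.
have /andP[c0 coo] := lebesgue_tuple_corner n.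
rewrite /uniform_simplex /= /distribution /pushforward /= /mnormalize /= /mrestr.
by rewrite !setTI gt_eqF// lt_eqF.
Qed.

End UniformSimplex.
Arguments uniform_simplex : clear implicits.

(* Main.v *)
Require Import Defs.
From mathcomp Require Import all_boot all_order all_algebra.
From mathcomp Require Import all_classical all_reals all_analysis.
From mathcomp Require Import measurable_realfun ring lra.

Set Implicit Arguments.
Unset Strict Implicit.
Unset Printing Implicit Defensive.

Import Order.TTheory GRing.Theory Num.Theory.
Import numFieldNormedType.Exports.

Local Open Scope ring_scope.
Local Open Scope classical_set_scope.

(* The integral formula is proved by induction on n.  In the chart
   (a_1, ..., a_n) of the simplex the integrand f^(n)(sum_i a_i x_i) is, as a
   function of a_1 alone, the derivative of f^(n-1)(c + a_1 d) / d with
   d = x_1 - x_0.  By Fubini it is integrable on almost every segment, and its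
   integral there is the difference of the values of f^(n-1)(sum_i a_i x_i) / d
   at the end points, which are points of the simplices spanned by the nodes
   without x_0 and without x_1.  This is the recursion of divided differences.

   As f^(n) is an arbitrary integrable derivative, the fundamental theorem of
   calculus is needed for every everywhere derivable F whose derivative is
   integrable.  It follows from F b - F a <= int |F'|, applied to the
   differences of F with primitives of continuous functions that approximate F'
   in L1.

   The mean value form is obtained without integrability: f minus its Lagrange
   interpolant vanishes at all nodes, so its n-th derivative has a zero. *)

(** * The fundamental theorem of calculus for integrable derivatives *)

(* Cousin's lemma, in the form needed for superadditive interval functions. *)
Lemma transitive_local_to_global (R : realType) (P : R -> R -> Prop) (a b : R) :
  a <= b -> (forall x y z, P x y -> P y z -> P x z) ->
  (forall x, a <= x <= b -> exists2 d, 0 < d &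
    forall z y, a <= z -> y <= b -> x - d < z <= x -> x <= y < x + d -> P z y) ->
  P a b.
Proof.
move=> ab Ptrans Ploc.
(* [S] collects the points that [P] links to [a]. The local link at its supremum either reaches [b]
   or passes beyond the supremum, which is absurd. *)
pose S := [set x | a <= x <= b /\ P a x].
have Sa : S a.
  have [|d d0 Pd] := Ploc a; first by rewrite lexx.
  by split; rewrite ?lexx//; apply: Pd => //; rewrite lexx ?andbT; lra.
have supS : has_sup S by split; [exists a|exists b => x [/andP[]]].
have aS : a <= sup S by apply: ub_le_sup => //; case: supS.
have Sb : sup S <= b by apply: ge_sup => [|x [/andP[]]]; [case: supS|].
have [|d d0 Pd] := Ploc (sup S); first by rewrite aS.
have [x [/andP[ax xb] Px] xS] := sup_adherent d0 supS.
have xleS : x <= sup S by apply: ub_le_sup; [case: supS|split => //; rewrite ax].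
have [bS|bS] := ltP b (sup S + d).
  by apply: (Ptrans _ _ _ Px); apply: Pd; rewrite ?ax ?xS ?Sb.
have : S (sup S + d / 2).
  split; first by apply/andP; split; lra.
  by apply: (Ptrans _ _ _ Px); apply: Pd; rewrite ?xS//; try lra.
move=> /(ub_le_sup (proj2 supS)); lra.
Qed.

(** Since x lies between z and y, the two first-order errors e (x - z) and e (y - x) add up to
    exactly e (y - z). *)
Lemma derivable_straddle (R : realType) (F : R -> R) (x e : R) :
  derivable F x 1 -> 0 < e ->
  exists2 d, 0 < d & forall z y, x - d < z <= x -> x <= y < x + d ->
    F y - F z <= (F^`()%classic x + e) * (y - z).
Proof.
move=> dF e0.
have /cvgrPdist_le/(_ _ e0) : h^-1 *: (F (h *: 1 + x) - F x) @[h --> 0^'] --> F^`()%classic x.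
  rewrite derive1E; exact: dF.
rewrite near_withinE => /nbhs_ballP[d /= d0 Fd].
(* The estimate is cleared of its denominator so that it also covers h = 0, that is z = x or y =
   x. *)
have key h : `|h| < d -> `|h * F^`()%classic x - (F (h + x) - F x)| <= e * `|h|.
  move=> hd; have [->|h0] := eqVneq h 0.
    by rewrite add0r !subrr mul0r subrr normr0 mulr0.
  have := Fd h; rewrite /ball /= sub0r normrN => /(_ hd h0).
  rewrite -[h%:A]/(h * 1) mulr1 -[_ *: _]/(h^-1 * _) => H.
  have -> : h * F^`()%classic x - (F (h + x) - F x) =
    (F^`()%classic x - h^-1 * (F (h + x) - F x)) * h by field.
  by rewrite normrM ler_wpM2r.
exists d => // z y /andP[dz zx] /andP[xy yd].
have := key (y - x); rewrite subrK ger0_norm ?subr_ge0// => /(_ _)/ler_normlP[|].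
  lra.
have := key (z - x); rewrite subrK ler0_norm ?subr_le0// => /(_ _)/ler_normlP[|].
  lra.
by move=> *; lra.
Qed.

(** The function |F'| is dominated, at a cost of e in the integral, by a sum of constants on open
    sets, the density of a measure [nu]. Openness makes F y - F z <= nu ]z, y] hold around each
    point, and Cousin's lemma extends it to [a, b]. *)
Lemma increment_le_integral_norm_derive1 (R : realType) (F : R -> R) (a b : R) :
  let mu := @lebesgue_measure R in
  a <= b -> (forall t, a <= t <= b -> derivable F t 1) ->
  measurable_fun `[a, b] (F^`()%classic : R -> R) ->
  ((F b - F a)%:E <= \int[mu]_(x in `[a, b]) `|F^`()%classic x|%:E)%E.
Proof.
move=> mu ab dF mg; set g := F^`()%classic.
apply/lee_addgt0Pr => e e0.
(* The share r (b - a) pays for rounding |F'| up to a multiple of r, the other r for enlarging the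
   level sets [E k] to open sets. *)
have [r r0 er] : exists2 r, 0 < r & e = r * (b - a) + r.
  exists (e / (b - a + 1)); first by rewrite divr_gt0//; lra.
  by field; lra.
have muab : mu `[a, b] = (b - a)%:E.
  rewrite /mu lebesgue_measure_itv/= lte_fin.
  by case: ltgtP ab => [ab _|//|-> _]; rewrite ?subrr.
pose E k := `[a, b] `&` [set x | k%:R * r <= `|g x| < k.+1%:R * r].
pose c k : R := k.+1%:R * r.
have c0 k : 0 < c k by rewrite mulr_gt0.
have mE k : measurable (E k).
  rewrite /E (_ : [set x | k%:R * r <= `|g x| < k.+1%:R * r] =
      (fun x => `|g x|) @^-1` `[k%:R * r, k.+1%:R * r[); last first.
    by apply/seteqP; split => x /=; rewrite in_itv.
  have mng : measurable_fun `[a, b] (fun x : R => `|g x|).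
    by apply: measurableT_comp.
  exact: mng.
have muE k : (mu (E k) < +oo)%E.
  apply: (@le_lt_trans _ _ (mu `[a, b])).
    apply: le_measure; rewrite ?inE; [exact: mE|exact: measurable_itv|by move=> x []].
  exact: compact_finite_measure (@segment_compact R a b).
(* Weighted by [c k], the excess of [V k] over [E k] stays below r / 2^(k+1), and these bounds sum
   to r. *)
have d0 k : 0 < (r / (2 ^ k.+1)%:R) / c k.
  by rewrite !divr_gt0 ?ltr0n ?expn_gt0.
pose V k := projT1 (cid (lebesgue_regularity_outer (mE k) (muE k) (d0 k))).
have VP k : [/\ open (V k), E k `<=` V k &
    (mu (V k `\` E k) < ((r / (2 ^ k.+1)%:R) / c k)%:E)%E].
  exact: (projT2 (cid (lebesgue_regularity_outer (mE k) (muE k) (d0 k)))).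
have mV k : measurable (V k) by apply: open_measurable; case: (VP k).
(* On the open set V k the measure nu has density at least (k + 1) r, which
   exceeds |F'| at the points of E k. *)
pose nu (A : set R) : \bar R := (\sum_(k <oo) (c k)%:E * mu (V k `&` A))%E.
have nut_ge0 A k : (0 <= (c k)%:E * mu (V k `&` A))%E.
  by rewrite mule_ge0// lee_fin ltW.
have mVI k A : measurable A -> measurable (V k `&` A).
  by move=> mA; apply: measurableI => //; exact: mV.
have nuadd x y z : x <= y -> y <= z ->
    (nu `]x, y] + nu `]y, z] = nu `]x, z])%E.
  move=> xy yz; rewrite /nu -nneseriesD//; apply: eq_eseriesr => k _.
  rewrite -ge0_muleDr// -measureU; [|exact: mVI|exact: mVI|].
    by rewrite -setIUr -itv_bndbnd_setU.
  rewrite setIACA (_ : `]x, y] `&` `]y, z] = set0) ?setI0//.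
  apply/seteqP; split => t //= []; rewrite !in_itv/= => /andP[_ ty] /andP[yt _].
  by move: (lt_le_trans yt ty); rewrite ltxx.
have nulow k z y : z <= y -> `]z, y] `<=` V k -> ((c k * (y - z))%:E <= nu `]z, y])%E.
  move=> zy zyV; apply: le_trans (nneseries_lim_ge k.+1 _) => //.
  rewrite big_nat_recr//= (setIidr zyV) /mu lebesgue_measure_itv/= lte_fin.
  apply: le_trans (leeDr _ _); last by rewrite sume_ge0.
  by case: ltgtP zy => [zy _|//|-> _]; rewrite ?subrr ?mulr0 ?mule0// -EFinB -EFinM.
have Fnu : ((F b - F a)%:E <= nu `]a, b])%E.
  pose P x y := x <= y /\ ((F y - F x)%:E <= nu `]x, y])%E.
  suff : P a b by case.
  apply: (@transitive_local_to_global R P) => //.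
    move=> x y z [xy Pxy] [yz Pyz]; split; first exact: le_trans yz.
    rewrite -(nuadd _ _ _ xy yz); apply: le_trans (leeD Pxy Pyz).
    by rewrite -EFinD lee_fin; lra.
  move=> x xab.
  pose k := Num.truncn (`|g x| / r).
  have : k%:R <= `|g x| / r < k.+1%:R by rewrite truncn_itv// divr_ge0// ltW.
  rewrite ler_pdivlMr// ltr_pdivrMr// => /[dup] gk /andP[_ gk2].
  have Ekx : E k x by split => //=; rewrite in_itv/=.
  have [oV EV _] := VP k.
  have /nbhs_ballP[d1 /= d10 dV] : nbhs x (V k) by apply: open_nbhs_nbhs; split; [|exact: EV].
  (* The slack [c k - g x] taken as error turns the slope F' x + e of the straddle bound into
     [c k]. *)
  have eta0 : 0 < c k - g x by rewrite subr_gt0; apply: le_lt_trans gk2; exact: ler_norm.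
  have [d2 d20 dd] := derivable_straddle (dF x xab) eta0.
  exists (Num.min d1 d2); first by rewrite lt_min d10.
  move=> z y az yb; rewrite ltrBlDr -ltrBlDl lt_min => /andP[/andP[xz1 xz2] zx].
  rewrite -ltrBlDl lt_min => /andP[xy /andP[xy1 xy2]].
  have zy : z <= y by exact: le_trans xy.
  split => //; apply: (@le_trans _ _ (c k * (y - z))%:E).
    rewrite lee_fin; apply: le_trans (dd z y _ _) _.
    - by rewrite zx andbT; lra.
    - by rewrite xy/=; lra.
    - by rewrite -/g addrC subrK.
  apply: nulow => // t /=; rewrite in_itv/= => /andP[zt ty]; apply: dV.
  by rewrite /ball/= ltr_norml; apply/andP; split; lra.
have EU : \bigcup_k E k = `[a, b].
  apply/seteqP; split=> [x [k _ []]//|x xab]; exists (Num.truncn (`|g x| / r)) => //.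
  split => //=; have : (Num.truncn (`|g x| / r))%:R <= `|g x| / r < (Num.truncn (`|g x| / r)).+1%:R.
    by rewrite truncn_itv// divr_ge0// ltW.
  by rewrite ler_pdivlMr// ltr_pdivrMr.
have tE : trivIset setT E.
  move=> i j _ _ [x [[_ /= /andP[i1 i2]] [_ /= /andP[j1 j2]]]].
  have := le_lt_trans i1 j2; have := le_lt_trans j1 i2.
  by rewrite !ltr_pM2r// !ltr_nat !ltnS => ij ji; apply/eqP; rewrite eqn_leq ij ji.
apply: (le_trans Fnu).
apply: (@le_trans _ _ (\sum_(k <oo) (\int[mu]_(x in E k) (`|g x| + r)%:E + (r / (2 ^ k.+1)%:R)%:E))%E).
  apply: lee_nneseries => // k _.
  apply: (@le_trans _ _ ((c k)%:E * (mu (E k) + ((r / (2 ^ k.+1)%:R) / c k)%:E))%E).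
    rewrite lee_pmul2l ?lte_fin//; have [oV EV muV] := VP k.
    apply: (@le_trans _ _ (mu (V k))).
      by apply: le_measure; rewrite ?inE; [exact: mVI|exact: mV|exact: subIsetl].
    have -> : mu (V k) = (mu (E k) + mu (V k `\` E k))%E.
      rewrite -measureU; first by rewrite setDUK.
      - exact: mE.
      - by apply: measurableD; [exact: mV|exact: mE].
      - by rewrite setDIK.
    by rewrite leeD2l// ltW.
  rewrite muleDr ?fin_num_adde_defl// -EFinM [X in (_ + X%:E)%E]mulrC.
  rewrite divfK ?gt_eqF// leeD2r// -integral_cst//.
  (* On [E k] the constant [c k] exceeds |F'| by at most r. *)
  apply: ge0_le_integral => //.
  - exact: mE.
  - by move=> x _; rewrite /= lee_fin ltW.
  - apply/measurable_EFinP; apply: measurable_funD => //.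
    by apply: measurableT_comp => //; apply: measurable_funS mg => //; exact: subIsetl.
  - move=> x [_ /= /andP[gx _]]; rewrite /= lee_fin /c -natr1; lra.
  exact: mE.
apply: (le_trans (@epsilon_trick R (fun k => \int[mu]_(x in E k) (`|g x| + r)%:E)%E r xpredT _ _)).
- by move=> k; apply: integral_ge0 => x _; rewrite lee_fin addr_ge0// ltW.
- exact: ltW.
- rewrite -ge0_integral_bigcup//.
  + rewrite EU; under eq_integral do rewrite EFinD.
    rewrite ge0_integralD//.
    * rewrite integral_cst; last exact: measurable_itv.
      rewrite -addeA leeD2l// -[X in (_ * X + _)%E]/(mu `[a, b]) muab.
      by rewrite -EFinM -EFinD -er.
    * by apply/measurable_EFinP; apply: measurableT_comp.
    * by move=> x _; rewrite lee_fin ltW.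
  + rewrite EU; apply/measurable_EFinP; apply: measurable_funD => //.
    by apply: measurableT_comp.
  + by move=> x _; rewrite lee_fin addr_ge0// ltW.
Qed.

Lemma continuous_antiderivative (R : realType) (phi : R -> R) (a b : R) :
  let mu := @lebesgue_measure R in
  a < b -> continuous phi ->
  exists Phi : R -> R,
    (forall t, a <= t <= b -> derivable Phi t 1 /\ Phi^`()%classic t = phi t) /\
    (\int[mu]_(x in `[a, b]) (phi x)%:E = (Phi b - Phi a)%:E)%E.
Proof.
move=> mu ab cphi.
(* Starting at a - 1, and working up to b + 1, keeps a and b interior, so that [Phi] has two-sided
   derivatives there. *)
pose Phi x := (\int[mu]_(t in [set` `[a - 1, x]]) phi t)%R.
have dPhi t : a <= t <= b -> derivable Phi t 1 /\ Phi^`()%classic t = phi t.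
  move=> /andP[at_ tb]; apply: (@continuous_FTC1_closed _ _ _ _ (b + 1)).
  - by lra.
  - apply: continuous_compact_integrable; first exact: segment_compact.
    exact: continuous_subspaceT.
  - by lra.
  - exact: cphi.
have cPhi t : a <= t <= b -> {for t, continuous Phi}.
  by move=> /dPhi[/derivable1_diffP/differentiable_continuous].
exists Phi; split => //; rewrite EFinB; apply: continuous_FTC2 => //.
- exact: continuous_subspaceT.
- split.
  + by move=> t; rewrite in_itv/= => /andP[? ?]; apply: (dPhi t _).1; lra.
  + by apply: cvg_at_right_filter; apply: cPhi; lra.
  + by apply: cvg_at_left_filter; apply: cPhi; lra.
- by move=> t; rewrite in_itv/= => /andP[? ?]; apply: (dPhi t _).2; lra.
Qed.

Lemma integral_derive1 (R : realType) (F : R -> R) (a b : R) :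
  let mu := @lebesgue_measure R in
  a <= b -> (forall t, a <= t <= b -> derivable F t 1) ->
  mu.-integrable `[a, b] (EFin \o F^`()%classic) ->
  (\int[mu]_(x in `[a, b]) (F^`()%classic x)%:E = (F b - F a)%:E)%E.
Proof.
move=> mu; rewrite le_eqVlt => /predU1P[<- _ _|ab dF ig].
  by rewrite set_itv1 integral_set1 subrr.
set g := F^`()%classic.
have mab : measurable (`[a, b] : set (measurableTypeR R)) by exact: measurable_itv.
have mg : measurable_fun `[a, b] g by case/integrableP : ig => /measurable_EFinP.
have [phi [cphi iphi phig]] := approximation_continuous_integrable
  mab (compact_finite_measure (@segment_compact R a b)) ig.
have fing : (\int[mu]_(x in `[a, b]) (g x)%:E)%E \is a fin_num.
  exact: integrable_fin_num.
rewrite -(fineK fing); congr EFin; apply/eqP; rewrite -subr_eq0 -normr_le0.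
apply/ler_addgt0Pl => e e0; rewrite addr0.
have [n phin] : exists n,
    (\int[mu]_(x in `[a, b]) `|(g x - phi n x)%:E| < (e / 2)%:E)%E.
  have e20 : 0 < e / 2 by rewrite divr_gt0.
  move/fine_cvgP : phig => [fin1 /cvgrPdist_lt/(_ _ e20) near1].
  have [n _ Hn] : \forall n \near \oo,
     (\int[mu]_(x in `[a, b]) `|(g x - phi n x)%:E| < (e / 2)%:E)%E.
    near=> n.
    have fn : (\int[mu]_(x in `[a, b]) `|(g x - phi n x)%:E|)%E \is a fin_num.
      by near: n; exact: fin1.
    rewrite -(fineK fn) lte_fin.
    have : `|0 - fine (\int[mu]_(x in `[a, b]) `|(g x - phi n x)%:E|)%E| < e / 2.
      by near: n; exact: near1.
    by rewrite sub0r normrN; apply: le_lt_trans; exact: ler_norm.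
  by exists n; apply: Hn => /=.
have [Phi [dPhi intPhi]] := continuous_antiderivative ab (cphi n).
have mphi : measurable_fun `[a, b] (phi n).
  by case/integrableP : (iphi n) => /measurable_EFinP.
have DB (G H : R -> R) t : derivable G t 1 -> derivable H t 1 ->
    (G - H)^`()%classic t = G^`()%classic t - H^`()%classic t.
  by move=> dG dH; rewrite !derive1E deriveB.
have mB : measurable_fun `[a, b] (fun x => g x - phi n x).
  exact: measurable_funB.
(* Used for the pairs (F, Phi) and (Phi, F): the two one-sided bounds together control the distance
   between the increments of F and Phi. *)
have half (G H : R -> R) :
    (forall t, a <= t <= b -> derivable G t 1) ->
    (forall t, a <= t <= b -> derivable H t 1) ->
    (forall t, a <= t <= b ->
      `|G^`()%classic t - H^`()%classic t| = `|g t - phi n t|) ->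
    measurable_fun `[a, b] (fun t => G^`()%classic t - H^`()%classic t) ->
    (G b - H b) - (G a - H a) < e / 2.
  move=> dG dH GH mGH; rewrite -lte_fin; apply: le_lt_trans phin.
  have EGH : {in `[a, b]%classic, (fun t => G^`()%classic t - H^`()%classic t) =1 (G - H)^`()%classic}.
    by move=> t; rewrite inE/= in_itv/= => tab; rewrite DB//; [exact: dG|exact: dH].
  apply: (le_trans (@increment_le_integral_norm_derive1 _ (G - H) a b (ltW ab) _ _)).
  - by move=> t tab; apply: derivableB; [exact: dG|exact: dH].
  - exact: eq_measurable_fun mGH.
  - rewrite le_eqVlt; apply/orP; left; apply/eqP; apply: eq_integral => t tab.
    by rewrite -EGH// GH//; move: tab; rewrite inE/= in_itv.
have dPhi1 t : a <= t <= b -> derivable Phi t 1 by move=> /dPhi[].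
have h1 : (F b - Phi b) - (F a - Phi a) < e / 2.
  apply: half => //.
    by move=> t /dPhi[_ ->].
  apply: eq_measurable_fun mB => t; rewrite inE/= in_itv/= => /dPhi[_ ->].
  by [].
have h2 : (Phi b - F b) - (Phi a - F a) < e / 2.
  apply: half => //.
    by move=> t /dPhi[_ ->]; rewrite distrC.
  apply: (@eq_measurable_fun _ _ _ _ _ (fun t => phi n t - g t)).
    by move=> t; rewrite inE/= in_itv/= => /dPhi[_ ->].
  exact: measurable_funB.
have h3 : `|fine (\int[mu]_(x in `[a, b]) (g x)%:E)%E - (Phi b - Phi a)| < e / 2.
  rewrite -lte_fin; apply: le_lt_trans phin.
  rewrite -abse_EFin EFinB fineK// -intPhi -integralB_EFin//.
  by apply: le_abse_integral => //; apply/measurable_EFinP.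
by move/ltr_normlP : h3 => [? ?]; apply/ler_normlP; split; lra.
Unshelve. all: by end_near. Qed.

(** * Divided differences *)

(* The term i = q vanishes, so that differences for distinct q are taken termwise. *)
Lemma divided_difference_lift (R : realType) (n : nat) (f : R -> R)
    (x : 'I_n.+2 -> R) (q : 'I_n.+2) : injective x ->
  divided_difference f (x \o lift q) =
  \sum_(i < n.+2) f (x i) * (x i - x q) / \prod_(j < n.+2 | j != i) (x i - x j).
Proof.
move=> xI; rewrite [RHS](bigD1_ord q)//= subrr mulr0 mul0r add0r.
apply: eq_bigr => i _; rewrite [in RHS](bigD1_ord q) ?neq_lift//=.
have xiq : x (lift q i) - x q != 0.
  by rewrite subr_eq0 (inj_eq xI) eq_sym neq_lift.
rewrite invfM [RHS]mulrA mulfK//.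
by congr (_ * _^-1); apply: eq_bigl => j; rewrite (inj_eq lift_inj).
Qed.

(** Once both differences run over all nodes, their numerators subtract to (x i - x q) - (x i - x p)
    = x p - x q. *)
Lemma divided_difference_rec (R : realType) (n : nat) (f : R -> R)
    (x : 'I_n.+2 -> R) (p q : 'I_n.+2) : injective x ->
  (x p - x q) * divided_difference f x =
  divided_difference f (x \o lift q) - divided_difference f (x \o lift p).
Proof.
move=> xI; rewrite !divided_difference_lift// -sumrB mulr_sumr.
by apply: eq_bigr => i _; field; apply/prodf_neq0 => j ji;
  rewrite subr_eq0 (inj_eq xI) eq_sym.
Qed.

(** * Mean value form by Lagrange interpolation *)

Lemma derive1n_horner (R : realType) (p : {poly R}) (k : nat) :
  (horner p)^`(k)%classic = horner (p^`(k)%R).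
Proof.
elim: k => [|k IH]; first by rewrite derivn0.
by rewrite derive1nS IH -derivE derivnS.
Qed.

(** Peels off the innermost derivative, whereas [derive1nS] peels off the outermost. *)
Lemma derive1nSn (R : realType) (f : R -> R) (k : nat) :
  f^`(k.+1)%classic = (f^`()%classic)^`(k)%classic.
Proof. by rewrite /derive1n iterSr. Qed.

Lemma n_times_differentiable_horner (R : realType) (p : {poly R}) (n : nat) :
  n_times_differentiable n (horner p).
Proof. by move=> k _ t; rewrite derive1n_horner; exact: derivable_horner. Qed.

Lemma derive1n_sub_horner (R : realType) (f : R -> R) (p : {poly R}) (n k : nat) :
  n_times_differentiable n f -> (k <= n)%N ->
  (fun t => f t - p.[t])^`(k)%classic =
  (fun t => f^`(k)%classic t - (p^`(k)%R).[t]).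
Proof.
move=> fn; elim: k => [|k IH] kn; first by rewrite derivn0.
rewrite derive1nS IH 1?ltnW// derivnS; apply/funext => t.
rewrite derive1E (@deriveB _ _ _ (f^`(k)%classic) (horner (p^`(k)%R))).
- by rewrite -!derive1E derivE.
- exact: fn.
- exact: derivable_horner.
Qed.

(** Rolle's theorem between consecutive zeros of h gives zeros of h', one fewer and again
    increasing; the induction continues with h'. *)
Lemma Rolle_derive1n (R : realType) (n : nat) (h : R -> R) (x : 'I_n.+1 -> R) :
  n_times_differentiable n h ->
  (forall i j : 'I_n.+1, (i < j)%N -> x i < x j) ->
  (forall i, h (x i) = 0) ->
  exists2 z : R, x ord0 <= z <= x ord_max & h^`(n)%classic z = 0.
Proof.
elim: n h x => [|n IH] h x hn xinc hx.
  by exists (x ord0); rewrite ?hx// (ord1 ord_max) lexx.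
have dh t : derivable h t 1 by exact: (hn 0%N).
(* [widen_ord] and [lift ord0] produce the consecutive indices i and i + 1. *)
have /fin_all_exists[c cP] (i : 'I_n.+1) : exists c,
    x (widen_ord (leqnSn _) i) < c < x (lift ord0 i) /\ h^`()%classic c = 0.
  have xx : x (widen_ord (leqnSn _) i) < x (lift ord0 i) by exact: xinc.
  have [|||c cx dc] := @Rolle R h _ _ xx.
  - by move=> t _; exact: dh.
  - apply: continuous_subspaceT => t.
    exact/differentiable_continuous/derivable1_diffP.
  - by rewrite !hx.
  - by exists c; rewrite derive1E derive_val; split => //; move: cx; rewrite in_itv.
have le_x (i j : 'I_n.+2) : (i <= j)%N -> x i <= x j.
  rewrite leq_eqVlt => /predU1P[/val_inj->//|ij]; exact/ltW/xinc.
have [||i|z /andP[zl zu] hz] := IH (h^`()%classic) c.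
- by move=> k kn t; rewrite -derive1nSn; exact: hn.
- move=> i j ij; have [/andP[_ ci] _] := cP i; have [/andP[cj _] _] := cP j.
  by apply: (lt_trans ci); apply: le_lt_trans cj; apply: le_x.
- by have [] := cP i.
exists z; last by rewrite derive1nSn.
have [/andP[c0 _] _] := cP ord0; have [/andP[_ cm] _] := cP ord_max.
apply/andP; split.
- by apply: le_trans zl; apply: le_trans (ltW c0); apply: le_x.
- by apply: (le_trans zu); apply: (le_trans (ltW cm)); apply: le_x.
Qed.

Lemma increasing_injective (R : realType) (n : nat) (x : 'I_n -> R) :
  (forall i j : 'I_n, (i < j)%N -> x i < x j) -> injective x.
Proof.
move=> xinc i j xij; apply: val_inj; case: (ltngtP i j) => // ij;
  by have := xinc _ _ ij; rewrite xij ltxx.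
Qed.

(** The denominators go with the values instead of the basis polynomials, so that the coefficients
    are the terms of [divided_difference]. *)
Definition lagrange (R : realType) (n : nat) (f : R -> R)
    (x : 'I_n.+1 -> R) : {poly R} :=
  \sum_(i < n.+1) (f (x i) / \prod_(j < n.+1 | j != i) (x i - x j)) *:
    \prod_(j < n.+1 | j != i) ('X - (x j)%:P).

Lemma horner_lagrange (R : realType) (n : nat) (f : R -> R) (x : 'I_n.+1 -> R) i :
  injective x -> (lagrange f x).[x i] = f (x i).
Proof.
move=> xI; rewrite /lagrange horner_sum (bigD1 i)//= [X in _ + X]big1 => [|k ki].
  rewrite addr0 hornerZ horner_prod.
  under [X in _ * X]eq_bigr do rewrite hornerXsubC.
  rewrite divfK//; apply/prodf_neq0 => j ji.
  by rewrite subr_eq0 (inj_eq xI) eq_sym.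
rewrite hornerZ horner_prod [X in _ * X](bigD1 i)/=; last by rewrite eq_sym.
by rewrite hornerXsubC subrr mul0r mulr0.
Qed.

(** Each product is monic of degree n, so the coefficient of X^n is the divided difference, and n
    derivations kill all lower terms. *)
Lemma derivn_lagrange (R : realType) (n : nat) (f : R -> R) (x : 'I_n.+1 -> R) :
  ((lagrange f x)^`(n))%R = (n`!%:R * divided_difference f x)%:P.
Proof.
have szP i : size (\prod_(j < n.+1 | j != i) ('X - (x j)%:P)) = n.+1.
  rewrite -big_filter size_prod_XsubC; congr _.+1.
  by rewrite size_filter -sum1_count sum1_card (cardC1 i) card_ord.
have lcP i : (\prod_(j < n.+1 | j != i) ('X - (x j)%:P))`_n = 1 :> R.
  have /monicP := monic_prod_XsubC (index_enum 'I_n.+1) (fun j => j != i) x.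
  by rewrite lead_coefE szP.
apply/polyP => k; rewrite coef_derivn coefC /lagrange.
rewrite coef_sum; case: k => [|k] /=.
  rewrite addn0 ffactnn -[LHS]mulr_natl; congr (_ * _).
  by apply: eq_bigr => i _; rewrite coefZ lcP mulr1.
rewrite big1 ?mul0rn// => i _; rewrite coefZ nth_default ?mulr0//.
by rewrite szP addnS ltnS leq_addr.
Qed.

Lemma divided_difference_mean_value (R : realType) (n : nat) (f : R -> R)
    (x : 'I_n.+1 -> R) :
  n_times_differentiable n f ->
  (forall i j : 'I_n.+1, (i < j)%N -> x i < x j) ->
  exists2 z : R, x ord0 <= z <= x ord_max &
    f^`(n)%classic z = n`!%:R * divided_difference f x.
Proof.
move=> fn xinc; have xI := increasing_injective xinc.
have [||i|z zx hz] := @Rolle_derive1n R n (fun t => f t - (lagrange f x).[t]) x.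
- move=> k kn t; rewrite (derive1n_sub_horner _ fn) 1?ltnW//.
  apply: (@derivableB _ _ _ (f^`(k)%classic) (horner ((lagrange f x)^`(k)%R))).
    exact: fn.
  exact: derivable_horner.
- exact: xinc.
- by rewrite horner_lagrange// subrr.
exists z => //; move: hz; rewrite (derive1n_sub_horner _ fn)//.
by rewrite derivn_lagrange hornerC => /eqP; rewrite subr_eq0 => /eqP.
Qed.

(** * Integration over the corner *)

(** The derivative is the pointwise limit of the continuous difference quotients with step 1 / (k +
    1). *)
Lemma measurable_derive1 (R : realType) (F : R -> R) :
  (forall t, derivable F t 1) -> measurable_fun setT (F^`()%classic : R -> R).
Proof.
move=> dF.
have cF : continuous F.
  by move=> t; exact/differentiable_continuous/derivable1_diffP.
pose h (k : nat) (t : R) := k.+1%:R * (F (k.+1%:R^-1 + t) - F t).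
apply: (@measurable_fun_cvg _ _ _ _ h) => [k|t _].
  apply: measurable_funM => //; apply: measurable_funB.
    apply: measurableT_comp; first exact: continuous_measurable_fun.
    exact: measurable_funD.
  exact: continuous_measurable_fun.
have := dF t => /cvg_ex[l Fl].
have -> : F^`()%classic t = l by rewrite derive1E; apply: cvg_lim Fl.
apply/cvgrPdist_lt => e e0.
move/cvgrPdist_lt : Fl => /(_ _ e0); rewrite near_withinE => /nbhs_ballP[d /= d0 Fd].
have : (\forall k \near \oo, (k.+1%:R^-1 : R) < d).
  exact: near_infty_natSinv_lt (PosNum d0).
apply: filterS => k kd.
have := Fd (k.+1%:R^-1); rewrite /ball/= sub0r normrN ger0_norm// => /(_ kd).
rewrite invr_neq0// => /(_ isT).
by rewrite /h invrK /GRing.scale/= mulr1.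
Qed.

(** * Transport of integrals along a map *)

Section image_measure.
Context d1 d2 (X : measurableType d1) (Y : measurableType d2) (R : realType).
Variables (phi : X -> Y) (mu : {measure set X -> \bar R}).
Variables (nu : {measure set Y -> \bar R}) (D : set Y) (f : Y -> \bar R).
Hypotheses (mphi : measurable_fun setT phi) (mD : measurable D).
Hypothesis mf : measurable_fun setT f.
Hypothesis nuE : forall A, measurable A -> A `<=` D -> nu A = mu (phi @^-1` A).

(** An integral over [D] sees [nu] only on measurable subsets of [D]. The restriction in [nuE]
    matters for the chart: [uniform_simplex] ignores what lies outside the simplex, Lebesgue measure
    does not. *)
Lemma ge0_integral_image_measure : (forall y, 0 <= f y)%E ->
  (\int[nu]_(y in D) f y = \int[mu]_(x in phi @^-1` D) (f \o phi) x)%E.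
Proof.
move=> f0; rewrite -ge0_integral_pushforward//; last exact: measurable_funTS.
exact: eq_measure_integral.
Qed.

Lemma integral_image_measure : mu.-integrable (phi @^-1` D) (f \o phi) ->
  (\int[nu]_(y in D) f y = \int[mu]_(x in phi @^-1` D) (f \o phi) x)%E.
Proof.
by move=> fi; rewrite -integral_pushforward//; exact: eq_measure_integral.
Qed.

End image_measure.

Lemma integrable_image_measure d1 d2 (X : measurableType d1)
    (Y : measurableType d2) (R : realType) (phi : X -> Y)
    (mu : {measure set X -> \bar R}) (nu : {measure set Y -> \bar R})
    (D : set Y) (f : Y -> \bar R) :
  measurable_fun setT phi -> measurable D -> measurable_fun setT f ->
  (forall A, measurable A -> A `<=` D -> nu A = mu (phi @^-1` A)) ->
  nu.-integrable D f -> mu.-integrable (phi @^-1` D) (f \o phi).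
Proof.
move=> mphi mD mf nuE /integrableP[_ fD]; apply/integrableP; split.
  by apply: (@measurable_funTS _ _ _ _ _ (f \o phi)); exact: measurableT_comp.
apply: le_lt_trans fD.
rewrite (@ge0_integral_image_measure _ _ _ _ _ phi mu nu D (fun y => `|f y|%E))//.
exact: measurableT_comp.
Qed.

(** * Slicing the corner by its first coordinate *)

Lemma measurable_cons_pair (R : realType) n :
  measurable_fun setT (@cons_pair R n).
Proof. exact: measurable_cons. Qed.

Lemma corner_cons_pair (R : realType) n (t : R) (w : n.-tuple R) :
  corner R n.+1 (cons_pair (t, w)) <->
  corner R n w /\ 0 <= t <= 1 - \sum_(i < n) tnth w i.
Proof.
have tl i : tnth (cons_pair (t, w)) (lift ord0 i) = tnth w i by rewrite tnthS.
have sumE : \sum_(i < n.+1) tnth (cons_pair (t, w)) i = t + \sum_(i < n) tnth w i.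
  by rewrite big_ord_recl; congr (_ + _); apply: eq_bigr => i _; exact: tl.
split.
- move=> [w0]; rewrite sumE => w1.
  have t0 : 0 <= t by exact: w0 ord0.
  have w0' i : 0 <= tnth w i by rewrite -tl.
  by split; [split => //|apply/andP; split]; lra.
- move=> [[w0 w1] /andP[t0 t1]]; split; last by rewrite sumE; lra.
  by move=> i; case: (unliftP ord0 i) => [j ->|->//]; rewrite tl.
Qed.

Section Fubini_corner.
Context (R : realType) (n : nat) (f : n.+1.-tuple R -> R).
Hypothesis mf : measurable_fun setT f.
Hypothesis intf : (lebesgue_tuple R n.+1).-integrable (corner R n.+1) (EFin \o f).

Let mu := @lebesgue_measure R.
Let D : set (measurableTypeR R * n.-tuple R) := @cons_pair R n @^-1` corner R n.+1.

Let mD : measurable D.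
Proof.
rewrite -[D]setTI; apply: measurable_cons_pair => //; exact: measurable_corner.
Qed.

Let intD : (mu \x lebesgue_tuple R n)%E.-integrable D
  (EFin \o f \o @cons_pair R n).
Proof.
apply: integrable_image_measure intf => //.
- exact: measurable_cons_pair.
- exact: measurable_corner.
- exact/measurable_EFinP.
Qed.

(** Fubini's theorem is applied on the whole product, to the extension by zero; its sections live on
    a segment, or vanish for w outside the corner. *)
Let sectionE w : (fun t => ((EFin \o f \o @cons_pair R n) \_ D) (t, w)) =
  if w \in corner R n then
    (fun t => (f (cons_pair (t, w)))%:E) \_ `[0, 1 - \sum_(i < n) tnth w i]
  else cst 0%E.
Proof.
apply/funext => t; rewrite patchE; case: ifPn => [|wc].
  rewrite inE => /(corner_cons_pair _ _)[cw tw].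
  by rewrite mem_set// patchE mem_set//= in_itv.
case: ifPn => // cw; rewrite patchE; case: ifPn => // tw.
case/negP: wc; rewrite inE; apply/corner_cons_pair.
by rewrite inE in cw; rewrite inE/= in_itv in tw.
Qed.

Lemma ae_integrable_corner_section :
  {ae lebesgue_tuple R n, forall w, corner R n w ->
    mu.-integrable `[0, 1 - \sum_(i < n) tnth w i]
      (fun t => (f (cons_pair (t, w)))%:E)}.
Proof.
have /ae_integrable2 := (integrable_mkcond _ mD).1 intD.
apply: filterS => w; rewrite sectionE => + cw.
rewrite mem_set// => h; apply/integrable_mkcond => //.
Qed.

Lemma integral_corner_recl :
  (\int[lebesgue_tuple R n.+1]_(v in corner R n.+1) (f v)%:E =
   \int[lebesgue_tuple R n]_(w in corner R n)
     \int[mu]_(t in `[0%R, (1 - \sum_(i < n) tnth w i)%R]) (f (cons_pair (t, w)))%:E)%E.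
Proof.
have mfE : measurable_fun setT (EFin \o f) by exact/measurable_EFinP.
transitivity (\int[(mu \x lebesgue_tuple R n)%E]_(p in D) (EFin \o f \o @cons_pair R n) p)%E.
  apply: integral_image_measure => //.
  - exact: measurable_cons_pair.
  - exact: measurable_corner.
rewrite integral_mkcond -integral21_prod_meas1; last exact: ((integrable_mkcond _ mD).1 intD).
rewrite [RHS]integral_mkcond; apply: eq_integral => w _.
rewrite /fubini_G sectionE patchE; case: ifPn => _; last exact: integral0.
by rewrite [RHS]integral_mkcond.
Qed.

(** Serves to replace the inner integral by an expression that equals it only almost everywhere. *)
Lemma measurable_corner_section :
  measurable_fun (corner R n) (fun w =>
    \int[mu]_(t in `[0%R, (1 - \sum_(i < n) tnth w i)%R]) (f (cons_pair (t, w)))%:E)%E.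
Proof.
apply/(measurable_restrictT _ (@measurable_corner R n)).
have := measurable_fubini_G ((integrable_mkcond _ mD).1 intD).
apply: eq_measurable_fun => w _.
rewrite /fubini_G sectionE patchE; case: ifPn => _; last exact: integral0.
by rewrite [RHS]integral_mkcond.
Qed.

End Fubini_corner.

(** * Affine combinations of the nodes in the chart *)

Definition affine_combination (R : realType) (n : nat) (x : 'I_n.+1 -> R)
    (v : n.-tuple R) : R :=
  \sum_(i < n.+1) tnth (simplex_chart v) i * x i.

Lemma affine_combination_recl (R : realType) (n : nat) (x : 'I_n.+1 -> R) v :
  affine_combination x v = (1 - \sum_(i < n) tnth v i) * x ord0 +
    \sum_(i < n) tnth v i * x (lift ord0 i).
Proof.
rewrite /affine_combination big_ord_recl; congr (_ + _).
by apply: eq_bigr => i _; rewrite tnthS.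
Qed.

(** The coordinate t moves weight from x_0 to x_1. Index 1 is [lift ord0 ord0], so t = 0 gives a
    point of the face without x_1. *)
Lemma affine_combination_cons_pair (R : realType) (n : nat) (x : 'I_n.+2 -> R)
    (t : R) (w : n.-tuple R) :
  affine_combination x (cons_pair (t, w)) =
  affine_combination (x \o lift (lift ord0 ord0)) w +
    t * (x (lift ord0 ord0) - x ord0).
Proof.
rewrite !affine_combination_recl !big_ord_recl /=.
have tl i : tnth (cons_pair (t, w)) (lift ord0 i) = tnth w i by rewrite tnthS.
have -> : tnth (cons_pair (t, w)) ord0 = t by [].
rewrite (eq_bigr (tnth w)) => [|i _]; last exact: tl.
rewrite [X in _ + (_ + X)](eq_bigr (fun i => tnth w i * x (lift ord0 (lift ord0 i)))); last first.
  by move=> i _; rewrite tl.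
have -> : lift (lift ord0 ord0) ord0 = ord0 :> 'I_n.+2 by apply: val_inj.
rewrite [X in _ = _ + X + _](eq_bigr (fun i => tnth w i * x (lift ord0 (lift ord0 i)))); last first.
  by move=> i _; congr (_ * x _); exact: val_inj.
by ring.
Qed.

(** At the other end of the segment, t = 1 - sum w, the weight of x_0 is used up and the point lies
    on the face without x_0. *)
Lemma affine_combination_lift0 (R : realType) (n : nat) (x : 'I_n.+2 -> R)
    (w : n.-tuple R) :
  affine_combination (x \o lift ord0) w =
  affine_combination (x \o lift (lift ord0 ord0)) w +
    (1 - \sum_(i < n) tnth w i) * (x (lift ord0 ord0) - x ord0).
Proof.
rewrite !affine_combination_recl /=.
have -> : lift (lift ord0 ord0) ord0 = ord0 :> 'I_n.+2 by apply: val_inj.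
rewrite [X in _ = _ + X + _](eq_bigr (fun i => tnth w i * x (lift ord0 (lift ord0 i)))); last first.
  by move=> i _; congr (_ * x _); exact: val_inj.
by ring.
Qed.

Lemma measurable_affine_combination (R : realType) (n : nat) (x : 'I_n.+1 -> R) :
  measurable_fun setT (affine_combination x).
Proof.
apply: measurable_sum => i; apply: measurable_funM => //.
apply: (@measurableT_comp _ _ _ _ _ _ (fun a : n.+1.-tuple R => tnth a i)).
  exact: measurable_tnth.
exact: measurable_simplex_chart.
Qed.

Lemma affine_combination_bound (R : realType) (n : nat) (x : 'I_n.+1 -> R) v :
  corner R n v -> `|affine_combination x v| <= \sum_(i < n.+1) `|x i|.
Proof.
rewrite corner_simplex => -[/= v0 v1].
apply: (le_trans (ler_norm_sum _ _ _)); apply: ler_sum => i _.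
rewrite normrM ger0_norm// ler_piMl//.
by rewrite -v1 (bigD1 i)//= lerDl sumr_ge0.
Qed.

(** On the corner the combinations stay in a compact interval, where g is bounded, and the corner
    has finite measure. *)
Lemma continuous_integrable_corner (R : realType) (n : nat) (g : R -> R)
    (x : 'I_n.+1 -> R) : continuous g ->
  (lebesgue_tuple R n).-integrable (corner R n)
    (fun v => (g (affine_combination x v))%:E).
Proof.
move=> cg; apply: (@measurable_bounded_integrable _ _ _ _ (g \o affine_combination x)).
- exact: measurable_corner.
- by have /andP[] := @lebesgue_tuple_corner R n.
- apply: measurable_funTS; apply: measurableT_comp.
    exact: continuous_measurable_fun.
  exact: measurable_affine_combination.
pose B := \sum_(i < n.+1) `|x i|.
have /compact_bounded[M [Mr gM]] :=
  continuous_compact (continuous_subspaceT cg) (@segment_compact R (- B) B).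
exists M; split => // r Mlr v cv; apply: gM Mlr _ _.
exists (affine_combination x v) => //=.
by rewrite in_itv/= -ler_norml affine_combination_bound.
Qed.

(** * The integral formula in the chart *)

Lemma integral_affine_derive1 (R : realType) (F : R -> R) (c d s : R) :
  let mu := @lebesgue_measure R in
  d != 0 -> 0 <= s -> (forall t, derivable F t 1) ->
  mu.-integrable `[0, s] (fun t => (F^`()%classic (c + t * d))%:E) ->
  (\int[mu]_(t in `[0%R, s]) (F^`()%classic (c + t * d))%:E =
   (d^-1 * (F (c + s * d) - F c))%:E)%E.
Proof.
move=> mu d0 s0 dF.
pose G t := d^-1 * F (c + t * d).
(* [L] is built from function operations so that its derivative is found by instance inference. *)
pose L : R -> R := cst c + d *: (@id R).
have LE t : L t = c + t * d by rewrite /L/= mulrC.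
have GL : G = d^-1 *: (F \o L) by apply/funext => t; rewrite /G -LE.
have Gd (t : R) : is_derive t (1 : R) G (F^`()%classic (c + t * d)).
  have dL : is_derive t (1 : R) L d.
    by apply: is_derive_eq; rewrite add0r scaler1.
  have dF_ : is_derive (L t) (1 : R) F (F^`()%classic (L t)).
    by rewrite derive1E; exact/derivableP.
  have dFL := is_derive1_comp dF_ dL.
  by rewrite GL; apply: is_derive_eq; rewrite LE /GRing.scale/= mulrCA mulVf// mulr1.
have GE t : G^`()%classic t = F^`()%classic (c + t * d).
  by rewrite derive1E derive_val.
under eq_integral do rewrite -GE.
move=> iF; rewrite integral_derive1//.
- by rewrite /G mul0r addr0 mulrBr.
- apply: (eq_integrable _ _ _ _ iF); first exact: measurable_itv.
  by move=> t _; rewrite /= GE.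
Qed.

Lemma Hermite_Genocchi_corner (R : realType) (n : nat) (f : R -> R)
    (x : 'I_n.+1 -> R) :
  n_times_differentiable n f -> injective x ->
  (lebesgue_tuple R n).-integrable (corner R n)
    (fun v => (f^`(n)%classic (affine_combination x v))%:E) ->
  (\int[lebesgue_tuple R n]_(v in corner R n)
    (f^`(n)%classic (affine_combination x v))%:E = (divided_difference f x)%:E)%E.
Proof.
elim: n x => [|n IH] x fn xI intf.
  rewrite (eq_integral (cst (f (x ord0))%:E)); last first.
    by move=> v _; rewrite affine_combination_recl !big_ord0 subr0 mul1r addr0.
  rewrite integral_cst; last exact: measurable_corner.
  (* In dimension 0 the measure is the Dirac mass at the empty tuple, which belongs to the
     corner. *)
  rewrite [X in (_ * X)%E](_ : _ = 1%E); last first.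
    by rewrite /= diracE mem_set//; split => [[]//|]; rewrite big_ord0.
  by rewrite mule1 /divided_difference big_ord1 big_pred0 ?invr1 ?mulr1// => j; rewrite ord1.
have dfn t : derivable f^`(n)%classic t 1 by exact: fn.
(* Continuity of f^(n) supplies the integrability that the induction hypothesis asks for on both
   faces. *)
have cfn : continuous f^`(n)%classic.
  by move=> t; exact/differentiable_continuous/derivable1_diffP.
pose d := x (lift ord0 ord0) - x ord0.
have d0 : d != 0 by rewrite subr_eq0 (inj_eq xI).
pose y := x \o lift ord0.
pose z := x \o lift (lift ord0 ord0 : 'I_n.+2).
have yI : injective y by move=> i j /xI /lift_inj.
have zI : injective z by move=> i j /xI /lift_inj.
have fn' : n_times_differentiable n f by move=> k kn; apply: fn; exact: ltnW.
have mG : measurable_fun setT (f^`(n.+1)%classic \o affine_combination x).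
  apply: measurableT_comp; last exact: measurable_affine_combination.
  exact: measurable_derive1.
have [iy iz] := (continuous_integrable_corner y cfn, continuous_integrable_corner z cfn).
have iyz : (lebesgue_tuple R n).-integrable (corner R n) (fun w =>
    (d^-1 * (f^`(n)%classic (affine_combination y w) -
             f^`(n)%classic (affine_combination z w)))%:E).
  have := integrableZl (@measurable_corner R n) d^-1
    (integrableB (@measurable_corner R n) iy iz).
  by apply: eq_integrable => //; exact: measurable_corner.
rewrite integral_corner_recl//.
(* The sections of f^(n+1) are integrable only for almost every w, so the fundamental theorem
   evaluates the inner integral only almost everywhere. *)
rewrite (ae_eq_integral (fun w => (d^-1 * (f^`(n)%classic (affine_combination y w) -
             f^`(n)%classic (affine_combination z w)))%:E)); first last.
- have := ae_integrable_corner_section mG intf.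
  apply: filterS => w h cw; have {h} := h cw.
  under [X in _.-integrable _ X -> _]funext do rewrite /= affine_combination_cons_pair.
  under eq_integral do rewrite /= affine_combination_cons_pair.
  move=> iw; rewrite integral_affine_derive1//.
    by rewrite -affine_combination_lift0.
  by case: cw => _; rewrite subr_ge0.
- by case/integrableP : iyz.
- exact: (measurable_corner_section mG intf).
- exact: measurable_corner.
under eq_integral do rewrite EFinM.
rewrite integralZl//; last 2 first.
- exact: measurable_corner.
- by apply: (integrableB _ iy iz); exact: measurable_corner.
rewrite integralB_EFin//; last exact: measurable_corner.
rewrite IH// IH// -EFinB -EFinM; congr EFin.
by rewrite -(divided_difference_rec f (lift ord0 ord0) ord0 xI) mulKf.
Qed.

(** * Volume of the corner and passage to the uniform measure *)

Lemma integral_mscale d (T : measurableType d) (R : realType)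
    (m : {measure set T -> \bar R}) (D : set T) (k : {nonneg R}) (f : T -> \bar R) :
  measurable D -> m.-integrable D f ->
  (\int[mscale k m]_(x in D) f x = k%:num%:E * \int[m]_(x in D) f x)%E.
Proof.
move=> mD intf; have mf : measurable_fun D f by case/integrableP : intf.
rewrite [LHS]integralE [in RHS]integralE muleBr//; last exact: integrable_add_def.
rewrite (@ge0_integral_mscale _ _ _ m D mD k (f^\+)%E)//; last exact: measurable_funepos.
by rewrite (@ge0_integral_mscale _ _ _ m D mD k (f^\-)%E)//; exact: measurable_funeneg.
Qed.

(* Hermite_Genocchi_corner for f = 'X^n, whose divided difference is 1. *)
Lemma lebesgue_tuple_cornerE (R : realType) (n : nat) :
  lebesgue_tuple R n (corner R n) = (n`!%:R^-1)%:E.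
Proof.
pose x (i : 'I_n.+1) : R := i%:R.
have xinc (i j : 'I_n.+1) : (i < j)%N -> x i < x j by rewrite ltr_nat.
have fn := @n_times_differentiable_horner R 'X^n n.
have fE t : (horner ('X^n : {poly R}))^`(n)%classic t = n`!%:R.
  by rewrite derive1n_horner derivnXn subnn ffactnn expr0 hornerMn hornerC.
have nf0 : n`!%:R != 0 :> R by rewrite pnatr_eq0 -lt0n fact_gt0.
(* The n-th derivative is constantly n!, so the mean value form yields the divided difference
   without expanding it. *)
have DD : divided_difference (horner ('X^n : {poly R})) x = 1.
  have [z _] := divided_difference_mean_value fn xinc.
  by rewrite fE -[LHS]mulr1 => /(mulfI nf0).
have /andP[_ coo] := @lebesgue_tuple_corner R n.
have int1 : (lebesgue_tuple R n).-integrable (corner R n) (fun v =>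
    ((horner ('X^n : {poly R}))^`(n)%classic (affine_combination x v))%:E).
  by apply: continuous_integrable_corner; rewrite derive1n_horner; exact: continuous_horner.
have := Hermite_Genocchi_corner fn (increasing_injective xinc) int1.
rewrite DD; under eq_integral do rewrite fE.
rewrite integral_cst; last exact: measurable_corner.
have inv (m : \bar R) : m \is a fin_num -> (n`!%:R%:E * m = 1)%E -> m = (n`!%:R^-1)%:E.
  case: m => //= r _; rewrite -EFinM => -[nr]; congr EFin.
  by apply: (mulfI nf0); rewrite nr divff.
by apply: inv; rewrite ge0_fin_numE.
Qed.

(** The factor n! is the inverse of the volume of the corner: on the simplex, [uniform_simplex] is
    the image under the chart of n! times Lebesgue measure. *)
Lemma integral_uniform_simplex (R : realType) (n : nat) (f : n.+1.-tuple R -> R) :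
  measurable_fun setT f ->
  (uniform_simplex R n).-integrable (simplex R n) (EFin \o f) ->
  (lebesgue_tuple R n).-integrable (corner R n) (EFin \o (f \o @simplex_chart R n)) /\
  (\int[uniform_simplex R n]_(a in simplex R n) (f a)%:E =
   n`!%:R%:E * \int[lebesgue_tuple R n]_(v in corner R n) (f (simplex_chart v))%:E)%E.
Proof.
move=> mf intf.
have mfE : measurable_fun setT (EFin \o f) by exact/measurable_EFinP.
pose k : {nonneg R} := NngNum (ler0n R n`!).
have k0 : 0 < n`!%:R :> R by rewrite ltr0n fact_gt0.
pose mu := mscale k (lebesgue_tuple R n).
have nuE A : measurable A -> A `<=` simplex R n ->
    uniform_simplex R n A = mu (@simplex_chart R n @^-1` A).
  move=> mA AD; rewrite uniform_simplexE lebesgue_tuple_cornerE /= invrK muleC.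
  by rewrite setIidl// corner_simplex; exact: preimage_subset.
have chartmu : mu.-integrable (corner R n) (EFin \o (f \o @simplex_chart R n)).
  rewrite corner_simplex; apply: integrable_image_measure intf => //.
  exact: measurable_simplex.
have mfc : measurable_fun (corner R n) (EFin \o (f \o @simplex_chart R n)).
  by case/integrableP : chartmu.
have chart : (lebesgue_tuple R n).-integrable (corner R n)
    (EFin \o (f \o @simplex_chart R n)).
  apply/integrableP; split => //.
  case/integrableP : chartmu => _.
  rewrite ge0_integral_mscale//; last 2 first.
  - exact: measurable_corner.
  - exact: measurableT_comp.
  (* An infinite integral would remain infinite after multiplication by n! > 0. *)
  set I := integral _ _ _; have : (0 <= I)%E by apply: integral_ge0 => v _; exact: abse_ge0.
  case: I => [r||]//= _; first by rewrite !ltry.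
  by rewrite gt0_muley// lte_fin.
split => //.
rewrite (@integral_image_measure _ _ _ _ _ (@simplex_chart R n) mu _ (simplex R n) (EFin \o f))//.
- by rewrite -corner_simplex integral_mscale//; exact: measurable_corner.
- exact: measurable_simplex.
- by rewrite -corner_simplex.
Qed.

(* For f merely n times differentiable, the n-th derivative need not be Lebesgue
   integrable; the integral formula is asserted whenever its integrand is. *)
Theorem lemma1 (R : realType) (n : nat) (hn : (1 <= n)%N) (f : R -> R)
    (hf : n_times_differentiable n f)
    (x : 'I_n.+1 -> R) (hx : forall i j : 'I_n.+1, (i < j)%N -> x i < x j) :
  ((uniform_simplex R n).-integrable (simplex R n)
      (fun a => (f^`(n)%classic (\sum_(i < n.+1) tnth a i * x i))%:E) ->
    divided_difference f x =
      (n`!%:R)^-1 *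
      \int[uniform_simplex R n]_(a in simplex R n)
        f^`(n)%classic (\sum_(i < n.+1) tnth a i * x i)) /\
  (exists2 z : R, x ord0 <= z <= x ord_max &
    f^`(n)%classic z = n`!%:R * divided_difference f x).
Proof.
split; last exact: divided_difference_mean_value.
move=> intf.
have mfn : measurable_fun setT (f^`(n)%classic : R -> R).
  (* As n >= 1, f^(n) is the derivative of the everywhere derivable f^(n-1), hence measurable. *)
  case: n hn hf {x hx intf} => // n _ fn.
  by rewrite derive1nS; apply: measurable_derive1 => t; exact: fn.
have mg : measurable_fun setT (fun a : n.+1.-tuple R =>
    f^`(n)%classic (\sum_(i < n.+1) tnth a i * x i)).
  apply: measurableT_comp => //; apply: measurable_sum => i.
  by apply: measurable_funM => //; exact: measurable_tnth.
have [intc intE] := integral_uniform_simplex mg intf.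
rewrite /Rintegral intE.
rewrite (Hermite_Genocchi_corner hf (increasing_injective hx) intc) /=.
by rewrite mulKf// pnatr_eq0 -lt0n fact_gt0.
Qed.
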